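(* Let $G$ be a connected semigraph with $n$ vertices and $m$ edges $e_1,\dots,e_m$, where $r_i$ is the number of vertices of $e_i$, and let $m_2$ be the number of quarter edges, $m_3$ the number of half edges with exactly one partial half edge, and $m_4$ the number of half edges with two partial half edges. Then $$\mathcal{E}(G)\leq \sqrt{n\left(\frac{1}{6}\sum_{i=1}^{m}r_i^2(r_i^2-1)-\frac{15}{8}m_2-\frac{3}{4}m_3-\frac{1}{2}m_4\right)}.$$
   Context: A semigraph $G=(V,E)$ has a finite vertex set $V=\{v_1,\dots,v_n\}$, $n\ge2$, and edges that are ordered tuples $(u_1,\dots,u_k)$, $k\ge2$, of distinct vertices, with any two edges sharing at most one vertex, and $(u_1,\dots,u_k)$ identified with $(u_k,\dots,u_1)$. In an edge $(u_1,\dots,u_k)$, $u_1,u_k$ are end vertices and $u_2,\dots,u_{k-1}$ middle vertices. A vertex is a pure end vertex if it is an end vertex of every edge containing it, and a middle end vertex if it is a middle vertex of at least one edge and an end vertex of at least one other edge. An edge $(u_1,\dots,u_k)$ is full if $u_1,u_k$ are pure end vertices; an edge with $k>2$ is a half edge if $u_1$ or $u_k$ is a middle end vertex; an edge $(u_1,u_2)$ is a quarter edge if both $u_1,u_2$ are middle end vertices, and a half edge if exactly one is a middle end vertex. In a half edge $(u_1,\dots,u_k)$, $(u_1,u_2)$ is a partial half edge if $u_1$ is a middle end vertex, and $(u_{k-1},u_k)$ is a partial half edge if $u_k$ is a middle end vertex. $G$ is connected if any two vertices $u,v$ are joined by a sequence of edges $e_{1},\dots,e_{p}$ with $u\in e_1$,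 $v\in e_p$ and $|e_j\cap e_{j+1}|=1$. For $u_i,u_j$ in an edge $e=(u_1,\dots,u_k)$, $d_e(u_i,u_j)=|i-j|$. The adjacency matrix $A=(a_{ij})$ is indexed by vertices: $a_{ij}=d_e(v_i,v_j)$ if $v_i,v_j$ lie in a common full or half edge $e$ and $(v_i,v_j)$ is neither a partial half edge nor a quarter edge; $a_{ij}=\frac12$ if $(v_i,v_j)$ is a partial half edge; $a_{ij}=\frac14$ if $(v_i,v_j)$ is a quarter edge; $a_{ij}=0$ otherwise. $A$ is symmetric; the energy $\mathcal{E}(G)$ is the sum of the absolute values of the eigenvalues of $A$. *)

(* Defs.v *)
From HB Require Import structures.
From mathcomp Require Import all_boot all_order all_algebra.
From mathcomp Require Import complex.

Set Implicit Arguments.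
Unset Strict Implicit.
Unset Printing Implicit Defensive.

Import Order.TTheory GRing.Theory Num.Theory.
Local Open Scope ring_scope.

(* The vertices are the elements of 'I_n and the m edges are indexed by 'I_m.
   An edge, which is a tuple up to reversal, is given by one of its two
   orientations; every notion below is invariant under reversal.  By [edge_meet]
   and [edge_size] two distinct indices never carry the same edge
   (lemma [edge_inj] below), so m is the number of edges. *)
Record semigraph (n m : nat) := Semigraph {
  edge :> 'I_m -> seq 'I_n;
  order_ge2 : (2 <= n)%N;
  edge_size : forall e, (2 <= size (edge e))%N;
  edge_uniq : forall e, uniq (edge e);
  edge_meet : forall e f, e != f ->
    (#|[set u in edge e] :&: [set u in edge f]| <= 1)%N
}.

Section Semigraph.
Variables (n m : nat) (G : semigraph n m).
Implicit Types (e f : 'I_m) (u v : 'I_n).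

Lemma edge_inj e f : G e = G f \/ G e = rev (G f) -> e = f.
Proof.
move=> H; apply/eqP; apply: contraT => /(edge_meet G).
have -> : [set u in G e] = [set u in G f].
  by apply/setP => u; rewrite !inE; case: H => ->; rewrite ?mem_rev.
by rewrite setIid cardsE (card_uniqP (edge_uniq G f)) leqNgt edge_size.
Qed.

Definition end_of e u : bool :=
  (u \in G e) && ((index u (G e) == 0%N) || (index u (G e) == (size (G e)).-1)).

Definition middle_of e u : bool :=
  (u \in G e) && (0 < index u (G e) < (size (G e)).-1)%N.

Definition pure_end u : bool := [forall e, (u \in G e) ==> end_of e u].

Definition middle_end u : bool :=
  [exists e, exists f, [&& e != f, middle_of e u & end_of f u]].

Definition full_edge e : bool := [forall u, end_of e u ==> pure_end u].

Definition quarter_edge e : bool :=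
  (size (G e) == 2) && [forall u, end_of e u ==> middle_end u].

Definition half_edge e : bool :=
  (2 < size (G e))%N && [exists u, end_of e u && middle_end u]
  || (size (G e) == 2) && (#|[set u | end_of e u && middle_end u]| == 1%N).

Definition edge_dist e u v : nat := `|index u (G e) - index v (G e)|%N.

Definition partial_at e u v : bool :=
  [&& end_of e u, middle_end u, v \in G e & edge_dist e u v == 1%N].

(* {u, v} is a partial half edge of the half edge e, as an unordered pair. *)
Definition partial_half_of e u v : bool :=
  half_edge e && (partial_at e u v || partial_at e v u).

(* Unordered pairs are counted through their increasing representative. *)
Definition n_partial_half e : nat :=
  #|[set p : 'I_n * 'I_n | (p.1 < p.2)%N && partial_half_of e p.1 p.2]|.

Definition is_partial_half u v : bool := [exists e, partial_half_of e u v].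

Definition is_quarter u v : bool :=
  [exists e, quarter_edge e && ((G e == [:: u; v]) || (G e == [:: v; u]))].

(* The edge picked in the last case is unique when u != v, by [edge_meet]; when
   u = v the value is 0 whichever edge is picked. *)
Definition adj_entry (R : rcfType) u v : R :=
  if is_quarter u v then 4^-1
  else if is_partial_half u v then 2^-1
  else if [pick e | (full_edge e || half_edge e) && (u \in G e) && (v \in G e)]
    is Some e then (edge_dist e u v)%:R
  else 0.

Definition adjacency (R : rcfType) : 'M[R]_n :=
  \matrix_(u, v) adj_entry R u v.

Definition connected : Prop :=
  forall u v, u != v ->
    exists e (p : seq 'I_m),
      [/\ path (fun f g => #|[set x in G f] :&: [set x in G g]| == 1%N) e p,
          u \in G e & v \in G (last e p)].

Definition n_quarter : nat := #|[set e | quarter_edge e]|.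

Definition n_half_with (k : nat) : nat :=
  #|[set e | half_edge e && (n_partial_half e == k)]|.

End Semigraph.

(* Eigenvalues listed with algebraic multiplicity. *)
Definition spectrum (C : closedFieldType) n (A : 'M[C]_n) : seq C :=
  sval (closed_field_poly_normal (char_poly A)).

Lemma spectrumP (C : closedFieldType) n (A : 'M[C]_n) :
  char_poly A = \prod_(z <- spectrum A) ('X - z%:P).
Proof.
rewrite /spectrum; case: closed_field_poly_normal => s /= {1}->.
by rewrite (monicP (char_poly_monic A)) scale1r.
Qed.

(* The eigenvalues are taken in R[i] and [normc] is the R-valued modulus, so
   that the definition does not presuppose that they are real. *)
Definition energy (R : rcfType) n m (G : semigraph n m) : R :=
  \sum_(z <- spectrum (map_mx (real_complex R) (adjacency G R))) Normc.normc z.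

(* Main.v *)
(** By Cauchy-Schwarz the energy is at most the square root of [n] times the sum
    of the squared moduli of the eigenvalues, which by Schur's inequality is at
    most the sum of the squared entries of the adjacency matrix.  The latter sum
    is distributed over the edges: an edge with [r] vertices contributes at most
    the sum of [(i - j)^2] over [i, j < r], that is [r^2 (r^2 - 1) / 6], and the
    entries [1/4] and [1/2] lower this contribution by [15/16] and [3/4] for
    each ordered pair of vertices. *)

Require Import Defs.
From HB Require Import structures.
From mathcomp Require Import all_boot all_order all_algebra.
From mathcomp Require Import complex.
From mathcomp Require Import ring lra.

Set Implicit Arguments.
Unset Strict Implicit.
Unset Printing Implicit Defensive.

Import Order.TTheory GRing.Theory Num.Theory.
Local Open Scope ring_scope.

(** * Sums of squared differences and power sums *)

(** Over an ordered ring the left side is nonnegative, which gives Cauchy-Schwarz; with [F] the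
    position along an edge, the identity evaluates the sum of squared distances. *)
Lemma sum_sqr_diff (R : comNzRingType) (I : Type) (s : seq I) (F : I -> R) :
  \sum_(i <- s) \sum_(j <- s) (F i - F j) ^+ 2 =
  2 * ((size s)%:R * (\sum_(i <- s) F i ^+ 2) - (\sum_(i <- s) F i) ^+ 2).
Proof.
set Q := \sum_(i <- s) F i ^+ 2; set S := \sum_(i <- s) F i.
transitivity (\sum_(i <- s) ((size s)%:R * F i ^+ 2 + Q - 2 * S * F i)).
  apply: eq_bigr => i _.
  have sqrB j : (F i - F j) ^+ 2 = F i ^+ 2 + F j ^+ 2 - 2 * F i * F j by ring.
  under eq_bigr do rewrite sqrB.
  rewrite sumrB big_split /= big_const_seq count_predT iter_addr_0 -/Q.
  rewrite -mulr_sumr -/S -[_ *+ size s]mulr_natl.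
  by ring.
rewrite sumrB big_split /= big_const_seq count_predT iter_addr_0.
rewrite -!mulr_sumr -/Q -/S -[_ *+ size s]mulr_natl.
by ring.
Qed.

Lemma sqr_sum_le (R : realDomainType) (I : Type) (s : seq I) (F : I -> R) :
  (\sum_(i <- s) F i) ^+ 2 <= (size s)%:R * \sum_(i <- s) F i ^+ 2.
Proof.
rewrite -subr_ge0 -(pmulr_rge0 _ (ltr0Sn R 1)) -sum_sqr_diff.
by do 2!apply: sumr_ge0 => ? _; apply: sqr_ge0.
Qed.

Lemma sum_nat_closed (R : comNzRingType) (r : nat) :
  2 * \sum_(i < r) i%:R = r%:R * (r%:R - 1) :> R.
Proof.
elim: r => [|r IHr]; first by rewrite big_ord0; ring.
by rewrite big_ord_recr /= mulrDr IHr -natr1; ring.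
Qed.

Lemma sum_nat_sqr_closed (R : comNzRingType) (r : nat) :
  6 * \sum_(i < r) i%:R ^+ 2 = r%:R * (r%:R - 1) * (2 * r%:R - 1) :> R.
Proof.
elim: r => [|r IHr]; first by rewrite big_ord0; ring.
by rewrite big_ord_recr /= mulrDr IHr -natr1; ring.
Qed.

(** * Unitary triangularisation *)

Section SchurInequality.
Local Open Scope sesquilinear_scope.

(** The scalar matrix of ['X] commutes with [P], so the whole characteristic matrix is conjugated
    and the determinants of [P] and its inverse cancel. *)
Lemma char_poly_conj (R : comUnitRingType) n (P A : 'M[R]_n) :
  P \in unitmx -> char_poly (P *m A *m invmx P) = char_poly A.
Proof.
move=> Pu; rewrite /char_poly.
have -> : char_poly_mx (P *m A *m invmx P) =
    map_mx polyC P *m char_poly_mx A *m map_mx polyC (invmx P).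
  rewrite /char_poly_mx mulmxBr mulmxBl -!map_mxM; congr (_ - _).
  by rewrite scalar_mxC -mulmxA -map_mxM mulmxV // map_mx1 mulmx1.
rewrite !det_mulmx mulrAC -det_mulmx -map_mxM mulmxV //.
by rewrite map_mx1 det1 mul1r.
Qed.

Lemma mxtrace_mulmx_trmxC (C : numClosedFieldType) n (A : 'M[C]_n) :
  \tr (A *m A^t*) = \sum_i \sum_j `|A i j| ^+ 2.
Proof.
apply: eq_bigr => i _; rewrite mxE; apply: eq_bigr => j _.
by rewrite !mxE normCK.
Qed.

(** A unitary change of basis makes [A] triangular, with its eigenvalues on the diagonal; the
    off-diagonal entries are then dropped. *)
Lemma Schur_inequality (C : numClosedFieldType) n (A : 'M[C]_n) : (0 < n)%N ->
  \sum_(z <- spectrum A) `|z| ^+ 2 <= \sum_i \sum_j `|A i j| ^+ 2.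
Proof.
move=> n_gt0; have [P Pu] := Schur A n_gt0.
rewrite /similar_to conjumx ?unitarymx_unit //.
have Pun := unitarymx_unit Pu.
set T := P *m A *m invmx P => Ttrig.
have specT : perm_eq (spectrum A) [seq T i i | i : 'I_n].
  apply: prod_XsubC_eq; rewrite -spectrumP big_image /=.
  by rewrite -(char_poly_conj A Pun) char_poly_trig.
(* The squared Frobenius norm is a trace, invariant under unitary conjugation. *)
have -> : \sum_i \sum_j `|A i j| ^+ 2 = \sum_i \sum_j `|T i j| ^+ 2.
  rewrite -!mxtrace_mulmx_trmxC /T invmx_unitary //.
  rewrite !trmx_mul !map_mxM trmxCK !mulmxA mulmxKtV //.
  by rewrite -!mulmxA [RHS]mxtrace_mulC !mulmxA mulmxKtV.
rewrite (perm_big _ specT) big_image /=; apply: ler_sum => i _.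
by rewrite (bigD1 i) //= lerDl sumr_ge0 // => j _; apply: exprn_ge0.
Qed.

End SchurInequality.

(** * From the eigenvalues to the entries *)

Lemma energy_le (R : rcfType) n m (G : semigraph n m) :
  energy R G <=
    Num.sqrt (n%:R * \sum_u \sum_v adj_entry G R u v ^+ 2).
Proof.
set A := map_mx (real_complex R) (adjacency G R).
have size_spec : size (spectrum A) = n.
  have := size_char_poly A.
  by rewrite spectrumP size_prod_XsubC => -[].
have sum_ge0 : 0 <= energy R G.
  by apply: sumr_ge0 => -[a b] _; apply: sqrtr_ge0.
have normcE2 (z : R[i]) : (Normc.normc z)%:C%C = `|z| by [].
rewrite -(ger0_norm sum_ge0) -sqrtr_sqr ler_wsqrtr //.
apply: le_trans (sqr_sum_le _ _) _; rewrite size_spec ler_wpM2l ?ler0n //.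
have := Schur_inequality A (ltnW (order_ge2 G)).
(* Schur's inequality lives in [R[i]], so the goal is carried there along the embedding of [R]. *)
rewrite -lecR !rmorph_sum /=.
under eq_bigr do rewrite -normcE2 -rmorphXn.
move=> /le_trans; apply; rewrite le_eqVlt; apply/orP; left; apply/eqP.
apply: eq_bigr => u _; rewrite rmorph_sum; apply: eq_bigr => v _.
rewrite !mxE -normcE2 /= expr0n addr0 sqrtr_sqr -rmorphXn.
by rewrite real_normK ?num_real.
Qed.

(** * Distributing the squared entries over the edges *)

Section EdgeContribution.
Variables (R : rcfType) (n m : nat) (G : semigraph n m).
Implicit Types (e : 'I_m) (u v : 'I_n).

(** The values are the squares of the entries 1/4 and 1/2, whose pairs are at distance 1. *)
Definition pair_coeff e u v : R :=
  if quarter_edge G e then 16^-1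
  else if partial_half_of G e u v then 4^-1 else 1.

Definition pair_weight e u v : R :=
  pair_coeff e u v * (edge_dist G e u v)%:R ^+ 2.

Lemma pair_weight_ge0 e u v : 0 <= pair_weight e u v.
Proof.
rewrite /pair_weight /pair_coeff mulr_ge0 ?sqr_ge0 //.
by case: ifP => _; last case: ifP => _; rewrite ?invr_ge0 ?ler01 ?ler0n.
Qed.

(** Only size 2 matters: a half edge then has a single middle end vertex [x], while a quarter edge
    would force both of its distinct ends to equal [x]. *)
Lemma half_edge_not_quarter e : half_edge G e -> quarter_edge G e = false.
Proof.
case/orP=> /andP[size_e]; first by rewrite /quarter_edge gtn_eqF.
move=> /cards1P[x defx]; apply/negbTE/negP => /andP[_ /forallP mid_end].
have ends u : end_of G e u -> u = x.
  move=> end_u; apply/set1P; rewrite -defx inE end_u.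
  by have /implyP := mid_end u; apply.
move: (edge_uniq G e) size_e ends; rewrite /end_of.
case: (G e) => [|a [|b []]] //=; rewrite inE andbT => neq_ab _ ends.
have ax : a = x by apply: ends; rewrite !inE eqxx.
have bx : b = x by apply: ends; rewrite !inE !eqxx (negbTE neq_ab) orbT.
by rewrite ax bx eqxx in neq_ab.
Qed.

Lemma partial_half_of_dist e u v : partial_half_of G e u v ->
  [/\ u \in G e, v \in G e & edge_dist G e u v = 1%N].
Proof.
case/andP=> _ /orP[] /and4P[/andP[ue _] _ ve /eqP d1]; split => //.
by rewrite /edge_dist distnC.
Qed.

Lemma edge_dist_id e u : edge_dist G e u u = 0%N.
Proof. exact: distnn. Qed.

Lemma quarter_edge_pair e u v :
    quarter_edge G e -> u \in G e -> v \in G e -> u != v -> is_quarter G u v.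
Proof.
move=> qe ue ve neq_uv; apply/existsP; exists e; rewrite qe /=.
case/andP: qe ue ve => size_e _; case: (G e) size_e => [|a [|b []]] //= _.
rewrite !inE => /orP[] /eqP eu /orP[] /eqP ev; move: neq_uv.
all: by rewrite eu ev !eqxx ?orbT.
Qed.

Lemma quarter_pair_dist e u v :
  (G e == [:: u; v]) || (G e == [:: v; u]) ->
  [/\ u \in G e, v \in G e & edge_dist G e u v = 1%N].
Proof.
move=> /orP[] /eqP Ge; have := edge_uniq G e; rewrite /edge_dist Ge /=.
  by rewrite !inE andbT !eqxx orbT => /negbTE ->.
by rewrite !inE andbT !eqxx orbT => /negbTE ->.
Qed.

(** The squared entry is 0 or equals one term of the sum, and the other terms are nonnegative. *)
Lemma adj_entry_sqr_le u v :
  adj_entry G R u v ^+ 2 <=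
    \sum_(e | (u \in G e) && (v \in G e)) pair_weight e u v.
Proof.
suff [->|[e [ue ve ->]]] : adj_entry G R u v = 0 \/ exists e,
    [/\ u \in G e, v \in G e & adj_entry G R u v ^+ 2 = pair_weight e u v].
- by rewrite expr0n; apply: sumr_ge0 => e _; apply: pair_weight_ge0.
- rewrite (bigD1 e) ?ue //= lerDl.
  by apply: sumr_ge0 => f _; apply: pair_weight_ge0.
rewrite /adj_entry /pair_weight /pair_coeff.
case: ifPn => [/existsP[e /andP[qe /quarter_pair_dist[ue ve d1]]]|nq].
  by right; exists e; rewrite qe d1; split => //; field.
case: ifPn => [/existsP[e part_e]|np].
  have [ue ve d1] := partial_half_of_dist part_e.
  have /half_edge_not_quarter nqe : half_edge G e by case/andP: part_e.
  by right; exists e; rewrite nqe part_e d1; split => //; field.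
case: pickP => [e /andP[/andP[_ ue] ve]|_]; last by left.
have [->|neq_uv] := eqVneq u v; first by left; rewrite edge_dist_id.
(* A coefficient other than 1 would put the pair in one of the two earlier cases of [adj_entry]. *)
right; exists e; split => //; case: ifPn => [qe|_].
  by rewrite (quarter_edge_pair qe ue ve neq_uv) in nq.
case: ifPn => [part_e|_]; last by rewrite mul1r.
by case/existsP: np; exists e.
Qed.

Lemma sum_edge_dist_sqr e (r := (size (G e))%:R : R) :
  \sum_(u in G e) \sum_(v in G e) (edge_dist G e u v)%:R ^+ 2 =
  1 / 6 * (r ^+ 2 * (r ^+ 2 - 1)).
Proof.
(* The positions of the vertices of [e] run once through the integers below its size. *)
have sum_index (F : nat -> R) :
    \sum_(u <- G e) F (index u (G e)) = \sum_(i < size (G e)) F i.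
  have [x0 _] : exists x, x \in G e.
    by case: (G e) (edge_size G e) => // x s _; exists x; rewrite mem_head.
  rewrite (big_nth x0) big_mkord; apply: eq_bigr => i _.
  by rewrite index_uniq ?edge_uniq.
rewrite -big_uniq ?edge_uniq //=.
under eq_bigr do rewrite -big_uniq ?edge_uniq //=.
under eq_bigr do under eq_bigr do
  rewrite /edge_dist natr_absz -rmorphXn real_normK ?num_real //
    rmorphXn rmorphB /=.
rewrite (sum_sqr_diff _ (fun u => (index u (G e))%:R)).
rewrite (sum_index (fun i => i%:R)) (sum_index (fun i => i%:R ^+ 2)) -/r.
have := sum_nat_closed R (size (G e)).
have := sum_nat_sqr_closed R (size (G e)).
rewrite -/r; set Q := \sum_(i < _) _ ^+ 2; set S := \sum_(i < _) _.
move=> HQ HS.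
have -> : Q = r * (r - 1) * (2 * r - 1) / 6 by rewrite -HQ; field.
have -> : S = r * (r - 1) / 2 by rewrite -HS; field.
by field.
Qed.

(** The right side counts ordered pairs, the left only increasing ones; this factor of 2 is given
    away. *)
Lemma n_partial_half_le e :
  (n_partial_half G e)%:R <=
    \sum_(u in G e) \sum_(v in G e) (partial_half_of G e u v)%:R :> R.
Proof.
rewrite pair_big_dep /= -natr_sum ler_nat /n_partial_half -sum1_card.
rewrite big_mkcond [leqRHS]big_mkcond /=; apply: leq_sum => -[u v] _ /=.
rewrite inE /=; case: ifP => // /andP[_ part_e].
by have [-> -> _] := partial_half_of_dist part_e; rewrite part_e.
Qed.

Lemma edge_contribution_le e (r := (size (G e))%:R : R) :
  \sum_(u in G e) \sum_(v in G e) pair_weight e u v <=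
  1 / 6 * (r ^+ 2 * (r ^+ 2 - 1)) - 15 / 8 * (quarter_edge G e)%:R
  - 3 / 4 * (half_edge G e && (n_partial_half G e == 1))%:R
  - 1 / 2 * (half_edge G e && (n_partial_half G e == 2))%:R.
Proof.
rewrite -sum_edge_dist_sqr /pair_weight /pair_coeff.
case: (boolP (quarter_edge G e)) => [qe|nqe].
  have -> : half_edge G e = false.
    by apply: contraTF qe => /half_edge_not_quarter ->.
  (* With two vertices the squared distances add up to 2, and 2/16 = 2 - 15/8. *)
  under eq_bigr do rewrite -mulr_sumr.
  rewrite -mulr_sumr sum_edge_dist_sqr.
  by case/andP: qe => /eqP -> _ /=; lra.
set S := (X in _ <= X - _ - _ - _); set N := n_partial_half G e.
(* Each partial half edge, at distance 1, loses 1 - 1/4 = 3/4. *)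
have part_le : \sum_(u in G e) \sum_(v in G e)
    (if partial_half_of G e u v then 4^-1 else 1) *
      (edge_dist G e u v)%:R ^+ 2 <= S - 3 / 4 * N%:R.
  rewrite lerBrDr -lerBrDl.
  apply: le_trans (ler_wpM2l _ (n_partial_half_le e)) _.
    by lra.
  rewrite /S -sumrB mulr_sumr ler_sum // => u _.
  rewrite -sumrB mulr_sumr ler_sum // => v _.
  case: ifPn => [/partial_half_of_dist[_ _ ->]|_]; rewrite /=; first by lra.
  by rewrite mul1r subrr mulr0.
apply: le_trans part_le _; rewrite /=.
have [->|neq1] := eqVneq N 1%N; first by case: (half_edge G e) => /=; lra.
(* Here the available loss is 3/2, more than the required 1/2. *)
have [->|neq2] := eqVneq N 2; first by case: (half_edge G e) => /=; lra.
by have := ler0n R N; rewrite !andbF /=; lra.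
Qed.

End EdgeContribution.

Theorem theorem2 (R : rcfType) (n m : nat) (G : semigraph n m)
    (Gconn : connected G) :
  let r (i : 'I_m) : R := (size (G i))%:R in
  let m2 : R := (n_quarter G)%:R in
  let m3 : R := (n_half_with G 1)%:R in
  let m4 : R := (n_half_with G 2)%:R in
  energy R G <=
    Num.sqrt (n%:R * (1 / 6 * (\sum_(i < m) r i ^+ 2 * (r i ^+ 2 - 1))
                      - 15 / 8 * m2 - 3 / 4 * m3 - 1 / 2 * m4)).
Proof.
rewrite /=; apply: le_trans (energy_le R G) _.
apply/ler_wsqrtr/ler_wpM2l; first exact: ler0n.
have card_sum (P : pred 'I_m) : #|[set e | P e]|%:R = \sum_e (P e)%:R :> R.
  rewrite -sum1dep_card natr_sum big_mkcond.
  by apply: eq_bigr => e _; case: (P e).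
rewrite /n_quarter /n_half_with !card_sum !mulr_sumr -!sumrB.
pose edge_sum e := \sum_(u in G e) \sum_(v in G e) pair_weight R G e u v.
apply: (@le_trans _ _ (\sum_e edge_sum e)); last first.
  by apply: ler_sum => e _; apply: edge_contribution_le.
(* Double counting of the triples formed by an edge and two of its vertices. *)
have -> : \sum_e edge_sum e = \sum_u \sum_v
    \sum_(e | (u \in G e) && (v \in G e)) pair_weight R G e u v.
  under [RHS]eq_bigr do under eq_bigr do rewrite big_mkcond /=.
  under [RHS]eq_bigr do rewrite exchange_big /=.
  rewrite [RHS]exchange_big; apply: eq_bigr => e _.
  rewrite /edge_sum big_mkcond; apply: eq_bigr => u _.
  by case: (u \in G e) => /=; [rewrite big_mkcond | rewrite big1].
by do 2!apply: ler_sum => ? _; apply: adj_entry_sqr_le.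
Qed.
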